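(* Let $(X,\mathrm{dist})$ be a compact metric space and let $f\colon X\to X$ be a homeomorphism. If every point of $X$ belongs to a quasi-attractor with shadowing (for $f$), then $f$ has the shadowing property.
   Context: A sequence $\{x_i\}_{i\in\mathbb{Z}}$ is a $\delta$-pseudo orbit of a homeomorphism $f$ of a compact metric space $X$ if $\mathrm{dist}(f(x_i),x_{i+1})<\delta$ for all $i\in\mathbb{Z}$. The homeomorphism $f$ has the shadowing property if for all $\varepsilon>0$ there is $\delta>0$ such that if $\{x_i\}_{i\in\mathbb{Z}}$ is a $\delta$-pseudo orbit in $X$ then there is $y\in X$ such that $\mathrm{dist}(f^i(y),x_i)<\varepsilon$ for all $i\in\mathbb{Z}$. A compact $f$-invariant (i.e. $f(A)=A$) subset $A\subset X$ is a quasi-attractor if for every open neighborhood $U$ of $A$ there is an open subset $V\subset U$ such that $A\subset V$ and $\mathrm{clos}(f(V))\subset V$, where $\mathrm{clos}$ denotes closure in $X$. If in addition the restricted homeomorphism $f\colon A\to A$ has the shadowing property, $A$ is called a quasi-attractor with shadowing. *)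

(* Defs.v *)
From HB Require Import structures.
From mathcomp Require Import all_boot all_order all_algebra.
From mathcomp Require Import all_classical all_reals all_analysis.

Set Implicit Arguments.
Unset Strict Implicit.
Unset Printing Implicit Defensive.

Import Order.TTheory GRing.Theory Num.Theory.

Local Open Scope classical_set_scope.
Local Open Scope ring_scope.

(* [Negz n] is the integer [- n.+1]. *)
Definition ziter (T : Type) (f : {inv T >-> T}) (i : int) (x : T) : T :=
  match i with
  | Posz n => iter n f x
  | Negz n => iter n.+1 (f^-1)%FUN x
  end.

Definition homeomorphism (X : topologicalType)
    (f : {splitbij [set: X] >-> [set: X]}) : Prop :=
  continuous f /\ continuous (f^-1)%FUN.

Definition pseudo_orbit (R : realType) (X : metricType R) (f : X -> X)
    (delta : R) (x : int -> X) : Prop :=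
  forall i : int, mdist (f (x i)) (x (i + 1)) < delta.

(* Shadowing property of the restriction f : A -> A, meant for f @` A = A:
   both the pseudo orbits and the shadowing points are taken in A. *)
Definition shadowing_on (R : realType) (X : metricType R)
    (f : {inv X >-> X}) (A : set X) : Prop :=
  forall eps : R, 0 < eps ->
  exists2 delta : R, 0 < delta &
    forall x : int -> X, (forall i, A (x i)) -> pseudo_orbit f delta x ->
    exists2 y : X, A y & forall i : int, mdist (ziter f i y) (x i) < eps.

Definition shadowing (R : realType) (X : metricType R)
    (f : {inv X >-> X}) : Prop :=
  shadowing_on f [set: X].

Definition quasi_attractor (X : topologicalType) (f : X -> X) (A : set X)
    : Prop :=
  [/\ compact A, f @` A = A &
    forall U : set X, open U -> A `<=` U ->
    exists V : set X,
      [/\ open V, V `<=` U, A `<=` V & closure (f @` V) `<=` V]].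

Definition quasi_attractor_with_shadowing (R : realType) (X : metricType R)
    (f : {inv X >-> X}) (A : set X) : Prop :=
  quasi_attractor f A /\ shadowing_on f A.

(* Main.v *)
Require Import Defs.
From HB Require Import structures.
From mathcomp Require Import all_boot all_order all_algebra.
From mathcomp Require Import all_classical all_reals all_analysis.
From mathcomp Require Import lra zify.

(** The idea is that forward pseudo orbits are trapped near quasi-attractors,
and that on a compact space tracing forward pseudo orbits is already enough.

Let A be a quasi-attractor with shadowing and let eps > 0.  Choose an open V
between A and a small neighborhood of A, with clos (f V) inside V.  As
clos (f V) is compact, it stays at positive distance from the complement of V,
so a pseudo orbit with small enough jumps that starts in V stays in V for all
positive times (quasi_attractor_trap).  Its points are then close to points
of A, and these form a pseudo orbit of the restriction f : A -> A, which can be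
completed in the past by a true orbit and traced by a point of A
(shadowing_on_forward).  Hence the forward pseudo orbits starting in V are
eps-traced, with a bound on the jumps depending only on A, V and eps
(quasi_attractor_shadows_nearby).

Since the quasi-attractors with shadowing cover X, these sets V form an open
cover, and compactness gives a single bound on the jumps that works for every
starting point (compact_uniform_radius).  Two-sided pseudo orbits are handled
by tracing them from time - n on, for every n, and letting n tend to infinity
(shadowing_of_forward). *)

Set Implicit Arguments.
Unset Strict Implicit.
Unset Printing Implicit Defensive.

Import Order.TTheory GRing.Theory Num.Theory.

Local Open Scope classical_set_scope.
Local Open Scope ring_scope.

(** * Uniform radii on compact metric spaces *)

Section metric.
Variables (R : realType) (X : metricType R).

Lemma open_mdist (U : set X) (x : X) : open U -> U x ->
  exists2 d : R, 0 < d & forall y, mdist x y < d -> U y.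
Proof.
move=> oU Ux; have /nbhs_ballP[d /= d0 dU] := open_nbhs_nbhs (conj oU Ux).
by exists d => // y xy; apply: dU; rewrite ballEmdist.
Qed.

Lemma continuous_mdist (g : X -> X) (x : X) (e : R) : continuous g -> 0 < e ->
  exists2 d : R, 0 < d & forall y, mdist x y < d -> mdist (g x) (g y) < e.
Proof.
move=> cg e0; have : nbhs x (g @^-1` ball (g x) e).
  by apply: cg; exact: nbhsx_ballx.
move=> /nbhs_ballP[d /= d0 dg]; exists d => // y xy.
by have := dg y; rewrite !ballEmdist; exact.
Qed.

(** The common form of the compactness arguments that produce uniform constants.
P is required at every radius smaller than the local one, because the radius
found by compactness is smaller than the local radii of a finite subcover. *)
Lemma compact_uniform_radius (K : set X) (P : R -> X -> Prop) : compact K ->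
  (forall x, K x -> exists2 d : R, 0 < d &
    forall r y, 0 < r < d -> mdist x y < d -> P r y) ->
  exists2 d : R, 0 < d & forall x, K x -> P d x.
Proof.
move=> /compact_near_coveringP cK loc.
have unif : \forall d \near 0^'+, K `<=` P d; last first.
  near (0 : R)^'+ => d; exists d; first by near: d; exact: nbhs_right_gt.
  by near: d; exact: unif.
apply: cK => x Kx; have [d d0 dP] := loc x Kx.
exists (ball x d, [set r | 0 < r < d]); last first.
  by move=> [y r] /= [] + /dP; rewrite ballEmdist => xy /(_ y); exact.
split=> /=; first exact: nbhsx_ballx.
near=> r; apply/andP; split; near: r;
  [exact: nbhs_right_gt|exact: nbhs_right_lt].
Unshelve. all: by end_near. Qed.

Lemma compact_open_margin (K V : set X) : compact K -> open V -> K `<=` V ->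
  exists2 d : R, 0 < d & forall x, K x -> forall y, mdist x y < d -> V y.
Proof.
move=> cK oV KV.
apply: (@compact_uniform_radius K (fun d x => forall y, mdist x y < d -> V y)).
  exact: cK.
move=> x Kx; have [d d0 dV] := open_mdist oV (KV x Kx).
(* A ball of radius d / 2 around y stays in the ball of radius d around x. *)
exists (d / 2) => [|r y /andP[r0 rd] xy z yz]; first by rewrite divr_gt0.
by apply: dV; have := metric_triangle x y z; lra.
Qed.

Lemma compact_continuous_uniform (g : X -> X) (e : R) :
  compact [set: X] -> continuous g -> 0 < e ->
  exists2 d : R, 0 < d & forall x y, mdist x y < d -> mdist (g x) (g y) < e.
Proof.
move=> cX cg e0.
have [||d d0 dP] := @compact_uniform_radius [set: X]
  (fun d x => forall y, mdist x y < d -> mdist (g x) (g y) < e).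
- exact: cX.
- move=> x _.
  have [|d d0 dg] := @continuous_mdist g x (e / 2) cg; first by lra.
  exists (d / 2) => [|r y /andP[r0 rd] xy z yz]; first by rewrite divr_gt0.
  have gxy : mdist (g x) (g y) < e / 2 by apply: dg; lra.
  have gxz : mdist (g x) (g z) < e / 2.
    by apply: dg; have := metric_triangle x y z; lra.
  have := metric_triangle (g y) (g x) (g z).
  by rewrite (metric_sym (g y) (g x)); lra.
- by exists d => // x y; exact: dP.
Qed.

End metric.

(** * Integer iterates and one-sided pseudo orbits *)

Section iterates.
Variables (X : Type) (f : {splitbij [set: X] >-> [set: X]}).

Lemma ziterS (i : int) (x : X) : ziter f (i + 1) x = f (ziter f i x).
Proof.
case: i => [n|[|n]].
- by rewrite (_ : n%:Z + 1 = n.+1%:Z) //; lia.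
- by rewrite /= invK ?inE.
- rewrite (_ : Negz n.+1 + 1 = Negz n); last by lia.
  by rewrite /= invK ?inE.
Qed.

Lemma ziterBn (m n : nat) (x : X) :
  ziter f (m%:Z - n%:Z) (iter n f x) = iter m f x.
Proof.
elim: m => [|m IH]; last first.
  by rewrite (_ : m.+1%:Z - n%:Z = m%:Z - n%:Z + 1) ?ziterS ?IH //; lia.
rewrite add0r; case: n => [//|n].
rewrite (_ : - n.+1%:Z = Negz n) //; elim: n => [|n IH].
  by rewrite /= funK ?inE.
by rewrite /= -iterS iterSr /= funK ?inE.
Qed.

End iterates.

Lemma ziter_continuous (X : topologicalType)
    (f : {splitbij [set: X] >-> [set: X]}) (i : int) :
  homeomorphism f -> continuous (ziter f i).
Proof.
have iter_cont (g : X -> X) n : continuous g -> continuous (iter n g).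
  move=> cg; elim: n => [|n IH] x /=; first exact: cvg_id.
  exact: (@continuous_comp _ _ _ (iter n g) g x (IH x) (cg _)).
by move=> [cf cf']; case: i => n; exact: iter_cont.
Qed.

Definition forward_pseudo_orbit (R : realType) (X : metricType R) (f : X -> X)
    (delta : R) (x : nat -> X) : Prop :=
  forall n : nat, mdist (f (x n)) (x n.+1) < delta.

(** * Shadowing near a quasi-attractor *)

Section shadowing.
Variables (R : realType) (X : metricType R).
Variables (f : {splitbij [set: X] >-> [set: X]}).

(** A forward pseudo orbit in A extends to a two-sided one by the backward
orbit of its first point, which stays in A since f is injective and f(A) = A;
the added jumps are all zero. *)
Lemma shadowing_on_forward (A : set X) (eps : R) :
  f @` A = A -> shadowing_on f A -> 0 < eps ->
  exists2 delta : R, 0 < delta & forall a : nat -> X, (forall n, A (a n)) ->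
    forward_pseudo_orbit f delta a ->
    exists2 y : X, A y & forall n, mdist (iter n f y) (a n) < eps.
Proof.
move=> fA shA /shA[delta delta0 sh]; exists delta => // a Aa po.
pose b (i : int) := if i is Posz n then a n else ziter f i (a 0%N).
have finvA x : A x -> A ((f^-1)%FUN x).
  by rewrite -{1}fA => -[y Ay <-]; rewrite funK ?inE.
have [||y Ay yP] := sh b.
- move=> [n|n] /=; first exact: Aa.
  by elim: n => [|n IH] /=; exact: finvA.
- move=> [n|[|n]]; first by rewrite (_ : n%:Z + 1 = n.+1%:Z); [exact: po|lia].
    by rewrite /= invK ?inE // mdistxx.
  rewrite (_ : Negz n.+1 + 1 = Negz n); last by lia.
  by rewrite /= invK ?inE // mdistxx.
- by exists y => // n; exact: (yP n).
Qed.

(** The compact set clos (f V) lies in the open set V, hence so does a uniform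
neighborhood of it: small errors cannot make a pseudo orbit leave V. *)
Lemma quasi_attractor_trap (A U : set X) :
  compact [set: X] -> quasi_attractor f A -> open U -> A `<=` U ->
  exists V : set X, [/\ open V, V `<=` U, A `<=` V &
    exists2 delta : R, 0 < delta &
      forall x y, V x -> mdist (f x) y < delta -> V y].
Proof.
move=> cX [cA fA qA] oU AU; have [V [oV VU AV fV]] := qA U oU AU.
exists V; split => //.
have cfV : compact (closure (f @` V)).
  by apply: (@subclosed_compact _ _ [set: X]) => //; exact: closed_closure.
have [delta delta0 dV] := compact_open_margin cfV oV fV.
exists delta => // x y Vx; apply: dV; apply: subset_closure.
by exists x.
Qed.

(** A pseudo orbit that never leaves a small neighborhood of A is replaced by
nearby points a n of A.  The jump from f (a n) to a n.+1 has three parts, each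
at most a third of the precision dA required by the shadowing in A: moving a n
to x n under f, the jump of x, and moving x n.+1 to a n.+1. *)
Lemma quasi_attractor_shadows_nearby (A : set X) (eps : R) :
  compact [set: X] -> continuous f ->
  quasi_attractor_with_shadowing f A -> 0 < eps ->
  exists V : set X, [/\ open V, A `<=` V &
    exists2 delta : R, 0 < delta & forall x : nat -> X, V (x 0%N) ->
      forward_pseudo_orbit f delta x ->
      exists y : X, forall n, mdist (iter n f y) (x n) < eps].
Proof.
move=> cX cf [qA shA] eps0.
have [_ fA _] := qA.
have [|dA dA0 shadow] := @shadowing_on_forward A (eps / 2) fA shA.
  by rewrite divr_gt0.
have [|eta eta0 fcont] := @compact_continuous_uniform _ _ f (dA / 3) cX cf.
  by rewrite divr_gt0.
pose rho := Num.min eta (Num.min (eps / 2) (dA / 3)).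
have rho0 : 0 < rho by rewrite !lt_min eta0 !divr_gt0.
pose U := \bigcup_(a in A) (ball a rho)^°.
have oU : open U.
  apply: bigcup_open => a _; exact: open_interior.
have AU : A `<=` U by move=> a Aa; exists a => //; exact: nbhsx_ballx.
have [V [oV VU AV [d d0 trap]]] := quasi_attractor_trap cX qA oU AU.
exists V; split => //.
exists (Num.min d (dA / 3)) => [|x Vx0 po]; first by rewrite lt_min d0 divr_gt0.
have Vx n : V (x n).
  elim: n => [//|n IH]; apply: (trap _ _ IH).
  by have := po n; rewrite lt_min => /andP[].
have /choice[a aP] n : exists a, A a /\ mdist a (x n) < rho.
  by have [a Aa /interior_subset] := VU _ (Vx n); rewrite ballEmdist; exists a.
have [||y _ yP] := shadow a; first by move=> n; have [] := aP n.
- move=> n; have [_] := aP n; have [_] := aP n.+1.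
  rewrite !lt_min => /and3P[_ _ ax1] /and3P[/fcont fax _ _].
  have := po n; rewrite lt_min => /andP[_ fx].
  have := metric_triangle (f (a n)) (f (x n)) (a n.+1).
  have := metric_triangle (f (x n)) (x n.+1) (a n.+1).
  by rewrite (metric_sym (x n.+1)); lra.
- exists y => n; have [_] := aP n; rewrite !lt_min => /and3P[_ ax _].
  by have := metric_triangle (iter n f y) (a n) (x n); have := yP n; lra.
Qed.

(** Tracing x from time - n on gives a point z_n, the n-th iterate of the
point tracing the shifted sequence x (j - n).  If no point eps-traced x, every
z would be eps-far from x at some time i, hence all points near z would be
(eps / 2)-far at that same time; by compactness the times involved are bounded
below by some - N, which contradicts the choice of z_N. *)
Lemma shadowing_of_forward : compact [set: X] -> homeomorphism f ->
  (forall eps : R, 0 < eps -> exists2 delta : R, 0 < delta &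
    forall x : nat -> X, forward_pseudo_orbit f delta x ->
    exists y : X, forall n, mdist (iter n f y) (x n) < eps) ->
  shadowing f.
Proof.
move=> cX hf fwd eps eps0; have [|delta delta0 sh] := fwd (eps / 2).
  by rewrite divr_gt0.
exists delta => // x _ po; apply: contrapT => nosh.
have escape z : exists i, eps <= mdist (ziter f i z) (x i).
  apply: contrapT => noi; apply: nosh; exists z => // i.
  by rewrite ltNge; apply/negP => ?; apply: noi; exists i.
have : \forall n \near \oo, [set: X] `<=` [set z |
    exists2 i : int, - n%:Z <= i & eps / 2 <= mdist (ziter f i z) (x i)].
  move/compact_near_coveringP : cX; apply => z _.
  have [i iP] := escape z.
  have : nbhs z (ziter f i @^-1` ball (ziter f i z) (eps / 2)).
    by apply: ziter_continuous => //; apply: nbhsx_ballx; rewrite divr_gt0.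
  move=> zi; exists (ziter f i @^-1` ball (ziter f i z) (eps / 2),
    [set n | (`|i| <= n)%N]) => /=.
    by split => //; exact: nbhs_infty_ge.
  move=> [w n] /= []; rewrite ballEmdist /= => zw ni; exists i; first by lia.
  by have := metric_triangle (ziter f i z) (ziter f i w) (x i); lra.
case=> N _ /(_ N (leqnn N)) far.
have [|y yP] := sh (fun j => x (j%:Z - N%:Z)).
  move=> j; rewrite (_ : j.+1%:Z - N%:Z = (j%:Z - N%:Z) + 1); last by lia.
  exact: po.
have [i Ni] := far (iter N f y) I.
have [j ->] : exists j : nat, i = j%:Z - N%:Z by exists (absz (i + N%:Z)); lia.
by rewrite ziterBn leNgt yP.
Qed.

End shadowing.

(** * Shadowing on the whole space *)

Theorem proposition3p4 (R : realType) (X : metricType R)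
    (f : {splitbij [set: X] >-> [set: X]})
    (compactX : compact [set: X])
    (homeo_f : homeomorphism f)
    (covered : forall x : X,
      exists2 A : set X, quasi_attractor_with_shadowing f A & A x) :
  shadowing f.
Proof.
apply: shadowing_of_forward => // eps eps0.
have [||delta delta0 sh] := @compact_uniform_radius _ _ [set: X]
  (fun delta x0 => forall x : nat -> X, x 0%N = x0 ->
    forward_pseudo_orbit f delta x ->
    exists y : X, forall n, mdist (iter n f y) (x n) < eps).
- exact: compactX.
- move=> x0 _; have [A qA Ax0] := covered x0.
  have [V [oV AV [d d0 shV]]] :=
    quasi_attractor_shadows_nearby compactX homeo_f.1 qA eps0.
  have [e e0 eV] := open_mdist oV (AV _ Ax0).
  exists (Num.min d e) => [|r z /andP[_]]; first by rewrite lt_min d0.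
  rewrite !lt_min => /andP[rd _] /andP[_ xz] x xz0 po.
  apply: shV => [|n]; first by rewrite xz0; exact: eV.
  exact: lt_trans (po n) rd.
- by exists delta => // x po; exact: (sh (x 0%N)).
Qed.
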